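(* Let $p<q<r$ be odd primes with $r<(p-1)(q-1)/(p-2)$, and write $\Psi_{pqr}(x)=\sum_k c_{pqr}(k)x^k$. (i) If $q\equiv -1\pmod p$ and $r\equiv -1\pmod p$, then $c_{pqr}(mr)=-1-m$ and $c_{pqr}((m+q)r)=m+1$ for every $0\le m\le p-2$, $c_{pqr}(2)=0$, and $V_{pqr}=\{-(p-1),-(p-2),\ldots,p-2,p-1\}$. (ii) If $q\equiv 1\pmod p$ and $r\equiv 1\pmod p$, then $c_{pqr}(1+mr)=1+m$ and $c_{pqr}(1+(m+q)r)=-1-m$ for every $0\le m\le p-2$, $c_{pqr}(2)=0$, and $V_{pqr}=\{-(p-1),-(p-2),\ldots,p-2,p-1\}$.
   Context: $\Phi_n(x)$ is the $n$-th cyclotomic polynomial, $\varphi$ is Euler's totient function, and $\Psi_n(x)=(x^n-1)/\Phi_n(x)=\sum_{k=0}^{n-\varphi(n)}c_n(k)x^k\in\mathbb Z[x]$. $V_n=\{c_n(k):0\le k\le n-\varphi(n)\}$ is the set of coefficient values of $\Psi_n$. *)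

(* Defs.v *)
From mathcomp Require Import all_boot all_order all_algebra all_field.

Set Implicit Arguments.
Unset Strict Implicit.
Unset Printing Implicit Defensive.

Import GRing.Theory Num.Theory.
Local Open Scope ring_scope.

(* 'Phi_n is monic, so the pseudo-division of {poly int} is here the exact    *)
(* quotient: inverse_cyclotomic n * 'Phi_n = 'X^n - 1.                        *)
Definition inverse_cyclotomic (n : nat) : {poly int} := ('X^n - 1) %/ 'Phi_n.

Definition inv_cyclo_coef (n k : nat) : int := (inverse_cyclotomic n)`_k.

(* The index k ranges over 0, ..., n - totient n inclusive; the set of values *)
(* is represented by a sequence (with repetitions), to be compared with =i.   *)
Definition inv_cyclo_values (n : nat) : seq int :=
  [seq inv_cyclo_coef n k | k <- iota 0 (n - totient n).+1].

Lemma inverse_cyclotomicK (n : nat) :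
  (0 < n)%N -> inverse_cyclotomic n * 'Phi_n = 'X^n - 1.
Proof.
move=> n_gt0; rewrite /inverse_cyclotomic.
rewrite -prod_Cyclotomic // (big_rem n) -?dvdn_divisors //= mulrC.
by rewrite Pdiv.IdomainMonic.mulKp ?Cyclotomic_monic.
Qed.

(* Main.v *)
(* Since 'Phi_(pqr) * 'Phi_(pq) is 'Phi_(pq) at X^r, the inverse polynomial is
   'Phi_(pq) * (1 + X^r + ... + X^((p-1)r)) * (X^(qr) - 1). As 'Phi_(pq) has
   degree (p-1)(q-1) < (p-1)r and coefficients in {-1, 0, 1}, each coefficient
   of the product is a signed sum of at most p-1 coefficients of 'Phi_(pq),
   taken along an arithmetic progression of difference r; this bounds it by p-1.
   Below pq, the coefficient of X^k in 'Phi_(pq) is [k in S] - [k-1 in S], with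
   S the numerical semigroup <p, q>. When q = r = -1 (mod p), jr lies in S and
   jr - 1 does not, for 0 <= j <= p-2; when q = r = 1 (mod p), jr lies in S and
   jr + 1 does not. So the coefficients along the progressions starting at 0,
   respectively at 1, are constantly 1, respectively -1, and their partial sums
   run through every value up to p-1 in absolute value. *)
Require Import Defs.
From mathcomp Require Import all_boot all_order all_algebra all_field.
From mathcomp Require Import zify ring.

Import Order.TTheory GRing.Theory Num.Theory.
Local Open Scope ring_scope.

(** * Factorisation of the inverse polynomial through ['Phi_(p * q)] *)

Lemma divisors_mul_prime (m r : nat) :
  (0 < m)%N -> prime r -> ~~ (r %| m)%N ->
  perm_eq (divisors (m * r)) (divisors m ++ [seq (d * r)%N | d <- divisors m]).
Proof.
move=> m_gt0 r_pr rNm.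
have r_gt0 := prime_gt0 r_pr.
have mr_gt0 : (0 < m * r)%N by rewrite muln_gt0 m_gt0.
apply: uniq_perm.
- exact: divisors_uniq.
- rewrite cat_uniq divisors_uniq map_inj_uniq ?divisors_uniq ?andbT /=; last first.
    by move=> x y /eqP; rewrite eqn_pmul2r // => /eqP.
  apply/hasPn => _ /mapP[d _ ->]; rewrite -dvdn_divisors //.
  by apply: contra rNm; apply: dvdn_trans; apply: dvdn_mull.
move=> d; rewrite mem_cat -!dvdn_divisors //.
apply/idP/orP=> [dmr|[dm|/mapP[e]]].
- have [/dvdnP[e de]|rNd] := boolP (r %| d)%N.
    right; apply/mapP; exists e => //.
    by move: dmr; rewrite de dvdn_pmul2r // dvdn_divisors.
  by left; move: dmr; rewrite Gauss_dvdl // coprime_sym prime_coprime.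
- exact: dvdn_mulr.
- by rewrite -dvdn_divisors // => em ->; rewrite dvdn_pmul2r.
Qed.

(** The divisors of [m * r] are the [d] and [d * r] with [d] dividing [m], so the product of either
    side over all such [d] is ['X^(m * r) - 1]. Strong induction cancels the factors with
    [d < m]. *)
Lemma Cyclotomic_mul_prime (m r : nat) :
  (0 < m)%N -> prime r -> ~~ (r %| m)%N ->
  'Phi_(m * r) * 'Phi_m = 'Phi_m \Po 'X^r.
Proof.
move=> + r_pr; elim/ltn_ind: m => m IH m_gt0 rNm.
have r_gt0 := prime_gt0 r_pr.
have mr_gt0 : (0 < m * r)%N by rewrite muln_gt0 m_gt0.
have : \prod_(d <- divisors m) ('Phi_(d * r) * 'Phi_d)
     = \prod_(d <- divisors m) ('Phi_d \Po 'X^r) :> {poly int}.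
  rewrite -(rmorph_prod (comp_poly ('X^r))) prod_Cyclotomic //=.
  rewrite comp_polyB comp_Xn_poly comp_polyC -exprM [(r * m)%N]mulnC.
  rewrite -(prod_Cyclotomic mr_gt0) (perm_big _ (divisors_mul_prime _ _ _ _ _)) //=.
  by rewrite big_cat big_map big_split; apply: mulrC.
have m_in : m \in divisors m by rewrite -dvdn_divisors.
rewrite (big_rem _ m_in) [RHS](big_rem _ m_in) /=.
rewrite [X in _ * X = _](eq_big_seq (fun d => 'Phi_d \Po 'X^r)) => [|d].
  apply: mulIf; rewrite prodf_seq_neq0; apply/allP => d _ /=.
  by rewrite comp_poly_eq0 ?size_polyXn // monic_neq0 ?Cyclotomic_monic.
rewrite mem_rem_uniq ?divisors_uniq // inE -dvdn_divisors // => /andP[d_neq dm].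
apply: IH (dvdn_gt0 m_gt0 dm) _.
  by rewrite ltn_neqAle d_neq dvdn_leq.
by apply: contra rNm => /dvdn_trans; apply.
Qed.

Lemma Cyclotomic1 : 'Phi_1 = 'X - 1.
Proof. by rewrite -['X]expr1 -prod_Cyclotomic // big_seq1. Qed.

Lemma Cyclotomic_prime (p : nat) :
  prime p -> 'Phi_p = \sum_(i < p) 'X^i.
Proof.
move=> p_pr; have X1_neq0 : 'X - 1 != 0 :> {poly int}.
  by rewrite -Cyclotomic1 monic_neq0 ?Cyclotomic_monic.
apply: (mulfI X1_neq0); rewrite -subrX1 -Cyclotomic1 mulrC -[X in 'Phi_X](mul1n p).
rewrite Cyclotomic_mul_prime ?dvdn1 ?neq_ltn ?prime_gt1 ?orbT //.
by rewrite Cyclotomic1 comp_polyB comp_polyX comp_polyC.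
Qed.

Lemma prime_dvd_prime_neq (p q : nat) :
  prime p -> prime q -> p != q -> ~~ (q %| p)%N.
Proof. by move=> p_pr q_pr; rewrite dvdn_prime2 // eq_sym. Qed.

Lemma Cyclotomic_mul2 (p q : nat) :
  prime p -> prime q -> p != q ->
  ('X^q - 1) * 'Phi_p * 'Phi_(p * q) = 'X^(p * q) - 1.
Proof.
move=> p_pr q_pr pq; rewrite -mulrA ['Phi_p * _]mulrC.
rewrite Cyclotomic_mul_prime ?prime_gt0 ?prime_dvd_prime_neq //.
have : ('X - 1) * 'Phi_p = 'X^p - 1 by rewrite (Cyclotomic_prime p p_pr) -subrX1.
move/(congr1 (comp_poly 'X^q)).
rewrite comp_polyM !comp_polyB comp_polyX comp_polyC comp_Xn_poly => ->.
by rewrite -exprM mulnC.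
Qed.

Lemma inverse_cyclotomic_mul3 (p q r : nat) :
  prime p -> prime q -> prime r -> p != q -> p != r -> q != r ->
  inverse_cyclotomic (p * q * r) =
  'Phi_(p * q) * (\sum_(i < p) 'X^(i * r)) * ('X^(q * r) - 1).
Proof.
move=> p_pr q_pr r_pr pq pr qr.
have n_gt0 : (0 < p * q * r)%N by rewrite !muln_gt0 !prime_gt0.
have rNpq : ~~ (r %| p * q)%N.
  by rewrite Euclid_dvdM // negb_or !prime_dvd_prime_neq.
apply: (mulIf (monic_neq0 (Cyclotomic_monic (p * q * r)))).
rewrite inverse_cyclotomicK //.
have := congr1 (comp_poly 'X^r) (Cyclotomic_mul2 p q p_pr q_pr pq).
rewrite !comp_polyM !comp_polyB comp_polyC !comp_Xn_poly -!exprM ![(r * _)%N]mulnC.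
move=> <-; rewrite -(Cyclotomic_mul_prime (p * q)) ?muln_gt0 ?prime_gt0 //.
rewrite (Cyclotomic_prime p p_pr) (raddf_sum (comp_poly 'X^r)).
under eq_bigr do rewrite /= comp_Xn_poly -exprM mulnC.
by rewrite polyC1; ring.
Qed.

Lemma inv_cyclo_coef_mul3 (p q r k : nat) :
  prime p -> prime q -> prime r -> p != q -> p != r -> q != r ->
  inv_cyclo_coef (p * q * r) k =
  \sum_(i < p) (('Phi_(p * q) * 'X^((i + q) * r))`_k -
                ('Phi_(p * q) * 'X^(i * r))`_k).
Proof.
move=> p_pr q_pr r_pr pq pr qr.
rewrite /inv_cyclo_coef inverse_cyclotomic_mul3 // mulr_sumr mulr_suml coef_sum.
by apply: eq_bigr => i _; rewrite mulrBr mulr1 coefB -mulrA -exprD mulnDl.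
Qed.

(** * Coefficients of ['Phi_(p * q)] and the semigroup generated by [p] and [q] *)

(* For k < pq this is the indicator function of the numerical semigroup <p, q>. *)
Definition nrep (p q k : nat) : nat :=
  #|[set x : 'I_q * 'I_p | (x.1 * p + x.2 * q == k)%N]|.

(** As [q] is invertible mod [p], the residue of [k] mod [p] determines [j < p], and then [k]
    determines [i]. *)
Lemma nrep_le1 (p q k : nat) : coprime p q -> (nrep p q k <= 1)%N.
Proof.
move=> co_pq; apply/card_le1_eqP => -[i j] [i' j']; rewrite !inE /= => /eqP<- /eqP e.
have p_gt0 : (0 < p)%N by apply: leq_ltn_trans (ltn_ord j).
have ej : j = j' :> nat.
  have : (j' * q == j * q %[mod p])%N by rewrite -(modnMDl i') e modnMDl.
  wlog : i j i' j' e / (j <= j')%N => [W h|le_jj'].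
    have [jj'|/ltnW jj'] := leqP j j'; first exact: W e jj' h.
    by apply/esym/(W i' j' i j (esym e) jj'); rewrite eq_sym.
  rewrite eqn_mod_dvd ?leq_mul2r ?le_jj' ?orbT // -mulnBl Gauss_dvdl // => d.
  have : (j' - j == 0)%N.
    by apply: contraTT d; rewrite -lt0n => ?; rewrite gtnNdvd // ltn_subLR // ltn_addl.
  by lia.
have ei : i = i' :> nat.
  by move: e; rewrite ej => /addIn/eqP; rewrite eqn_pmul2r // => /eqP->.
by congr (_, _); apply/val_inj.
Qed.

Lemma nrep_eq1 (p q i j : nat) :
  coprime p q -> (i < q)%N -> (j < p)%N -> nrep p q (i * p + j * q) = 1%N.
Proof.
move=> co_pq iq jp; apply/eqP; rewrite eqn_leq nrep_le1 //=.
by apply/card_gt0P; exists (Ordinal iq, Ordinal jp); rewrite inE.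
Qed.

(** A representation [k = i * p + j' * q] would have [j' < j], and [p] would divide [(j - j') * q],
    hence [j - j'], which lies strictly between 0 and [p]. *)
Lemma nrep_eq0 (p q j k : nat) :
  coprime p q -> (j < p)%N -> (k < j * q)%N -> (p %| j * q - k)%N ->
  nrep p q k = 0%N.
Proof.
move=> co_pq jp kj d; apply/eqP; rewrite cards_eq0 -subset0; apply/subsetP => -[i j'].
rewrite !inE /= => /eqP ek; move: kj d; rewrite -ek => kj.
have jj' : (j' < j)%N.
  by rewrite -(ltn_pmul2r (_ : 0 < q)%N) ?(leq_ltn_trans _ (ltn_ord i)) //; lia.
rewrite addnC subnDA -mulnBl => d.
have : (p %| (j - j') * q)%N.
  by rewrite -(subnK (_ : i * p <= (j - j') * q)%N) ?dvdn_addl ?dvdn_mull // mulnBl; lia.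
by rewrite Gauss_dvdl // gtnNdvd //; lia.
Qed.

(** The generating polynomial [H] of [nrep] is a product of two geometric sums, whence ['Phi_(p * q)
    * ('X^(p * q) - 1) = H * ('X - 1)]. Below degree [p * q] the left side is just
    [- 'Phi_(p * q)]. *)
Lemma coef_Cyclotomic_mul2 (p q k : nat) :
  prime p -> prime q -> p != q -> (k < p * q)%N ->
  'Phi_(p * q)`_k = (nrep p q k)%:R - (if k is k'.+1 then (nrep p q k')%:R else 0).
Proof.
move=> p_pr q_pr pq kpq.
have [p_gt0 q_gt0] := (prime_gt0 p_pr, prime_gt0 q_pr).
pose H : {poly int} := \sum_(x : 'I_q * 'I_p) 'X^(x.1 * p + x.2 * q).
have coefH j : H`_j = (nrep p q j)%:R.
  rewrite coef_sum /nrep -sum1_card natr_sum /= [RHS]big_mkcond /=.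
  by apply: eq_bigr => x _; rewrite coefXn inE eq_sym; case: eqP.
have HE : ('X^p - 1) * ('X^q - 1) * H = ('X^(p * q) - 1) ^+ 2.
  have -> : H = (\sum_(i < q) 'X^p ^+ i) * \sum_(j < p) 'X^q ^+ j.
    rewrite big_distrlr pair_bigA; apply: eq_bigr => x _.
    by rewrite /= -!exprM -exprD [(p * _)%N]mulnC [(q * _)%N]mulnC.
  by rewrite mulrACA -!subrX1 -!exprM [(q * p)%N]mulnC expr2.
have : 'Phi_(p * q) * ('X^(p * q) - 1) = H * ('X - 1).
  apply: (@mulfI _ (('X^p - 1) * ('X^q - 1))).
    by rewrite mulf_neq0 // monic_neq0 // monic_Xn_sub_1.
  have := Cyclotomic_mul2 p q p_pr q_pr pq.
  rewrite (Cyclotomic_prime p p_pr) => e; rewrite [RHS]mulrA HE.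
  by rewrite (subrX1 'X p) expr2 -{2}e; ring.
move/(congr1 (fun P : {poly int} => P`_k)).
rewrite !mulrBr !mulr1 !coefB coefMXn kpq coefMX !coefH sub0r.
by case: k {kpq} => [|k] /= /(congr1 -%R); rewrite opprK => ->; rewrite opprB // coefH.
Qed.

Lemma nrep_small (p q k : nat) :
  (0 < k)%N -> (k < p)%N -> (k < q)%N -> nrep p q k = 0%N.
Proof.
move=> k_gt0 kp kq; apply/eqP; rewrite cards_eq0 -subset0; apply/subsetP => -[i j].
by rewrite !inE /=; case: (i : nat) (j : nat) => [|i'] [|j'] /eqP; nia.
Qed.

Lemma nth_Cyclotomic_mul2 (p q k : nat) :
  prime p -> prime q -> p != q -> ((p - 1) * (q - 1) < k)%N -> 'Phi_(p * q)`_k = 0.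
Proof.
move=> p_pr q_pr pq lek; rewrite nth_default // size_Cyclotomic.
by rewrite totient_coprime ?prime_coprime ?dvdn_prime2 // !totient_prime // -!subn1.
Qed.

Lemma norm_coef_Cyclotomic_mul2 (p q k : nat) :
  prime p -> prime q -> p != q -> `|'Phi_(p * q)`_k| <= 1.
Proof.
move=> p_pr q_pr pq; have co_pq : coprime p q by rewrite prime_coprime ?dvdn_prime2.
have [p_gt1 q_gt1] := (prime_gt1 p_pr, prime_gt1 q_pr).
have [kpq|lek] := ltnP k (p * q); last by rewrite nth_Cyclotomic_mul2 ?normr0 //; nia.
rewrite coef_Cyclotomic_mul2 //; have := nrep_le1 p q k co_pq.
case: k {kpq} => [|k]; last have := nrep_le1 p q k co_pq; lia.
Qed.

(** * Coefficients of the inverse polynomial: bound and values along progressions *)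

Lemma sum_window_le (t m N : nat) :
  (\sum_(j < N) ((j <= t) && (t < j + m)) <= m)%N.
Proof.
(* The indices counted lie in the interval from [t.+1 - m] to [t], cut off at [N]; this sharper
   bound is inductive in [N]. *)
suff : (\sum_(j < N) ((j <= t) && (t < j + m)) <= minn N t.+1 - (t.+1 - m))%N by lia.
elim: N => [|N IH]; first by rewrite big_ord0.
rewrite big_ord_recr /=; move: IH; set S := (\sum_(j < N) _)%N.
by case: (leqP N t); case: (ltnP t (N + m)) => /=; lia.
Qed.

Section InverseCyclotomicCoefficients.

Variables p q r : nat.
Hypotheses (p_pr : prime p) (q_pr : prime q) (r_pr : prime r).
Hypotheses (lt_pq : (p < q)%N) (lt_qr : (q < r)%N).

Let pq : p != q. Proof. by rewrite neq_ltn lt_pq. Qed.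
Let pr : p != r. Proof. by rewrite neq_ltn (ltn_trans lt_pq lt_qr). Qed.
Let qr : q != r. Proof. by rewrite neq_ltn lt_qr. Qed.
Let p_gt1 : (1 < p)%N. Proof. exact: prime_gt1. Qed.

(** The degree [(p - 1) * (q - 1)] of ['Phi_(p * q)] is less than [(p - 1) * r]. *)
Lemma coef_CyclotomicMXn_out (j k : nat) :
  ~~ ((j * r <= k) && (k < (j + (p - 1)) * r))%N ->
  ('Phi_(p * q) * 'X^(j * r))`_k = 0.
Proof.
move=> out; rewrite coefMXn; case: (ltnP k (j * r)) => // jk.
have : ((j + (p - 1)) * r <= k)%N by move: out; rewrite jk -leqNgt.
by move=> h; rewrite nth_Cyclotomic_mul2 //; nia.
Qed.

Lemma norm_coef_CyclotomicMXn (j k : nat) :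
  `|('Phi_(p * q) * 'X^(j * r))`_k| <= ((j <= k %/ r) && (k %/ r < j + (p - 1)))%N%:R.
Proof.
have r_gt0 := prime_gt0 r_pr; rewrite leq_divRL // ltn_divLR //.
have [_|out] := boolP (_ && _); last by rewrite coef_CyclotomicMXn_out ?normr0.
by rewrite coefMXn; case: ifP => _; rewrite ?normr0 ?norm_coef_Cyclotomic_mul2.
Qed.

Lemma norm_inv_cyclo_coef_mul3 (k : nat) :
  `|inv_cyclo_coef (p * q * r) k| <= p%:Z - 1.
Proof.
rewrite inv_cyclo_coef_mul3 // sumrB.
pose w j : nat := ((j <= k %/ r) && (k %/ r < j + (p - 1)))%N.
have wP j : `|('Phi_(p * q) * 'X^(j * r))`_k| <= (w j)%:R.
  exact: norm_coef_CyclotomicMXn.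
have le_w (F : nat -> nat) :
    `|\sum_(i < p) ('Phi_(p * q) * 'X^(F i * r))`_k| <= (\sum_(i < p) w (F i))%:R.
  by rewrite natr_sum; apply: le_trans (ler_norm_sum _ _ _) (ler_sum _ _).
(* Since [p < q], the shifts [i] and [i + q] are distinct indices below [q + p], and at most [p - 1]
   indices have [k %/ r] in their window. *)
have split_le : (\sum_(i < p) w (i + q) + \sum_(i < p) w i <= p - 1)%N.
  apply: leq_trans (sum_window_le (k %/ r) (p - 1) (q + p)).
  rewrite big_split_ord addnC /= (big_ord_widen q w (ltnW lt_pq)) leq_add //.
    by rewrite [leqRHS](bigID (fun i : 'I_q => i < p)%N) /= leq_addr.
  by apply: leq_sum => i _; rewrite addnC.
apply: le_trans (ler_normB _ _) _.
apply: le_trans (lerD (le_w (addn^~ q)) (le_w id)) _.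
rewrite -natrD; apply: (@le_trans _ _ (p - 1)%N%:R); first by rewrite ler_nat.
by rewrite natrB ?prime_gt0 // natz.
Qed.

(** In each block of shifts exactly those with [i <= m] contribute, each giving [s]. At [e + m * r]
    the block shifted by [q] has not begun; at [e + (m + q) * r] the unshifted block has ended,
    because [2 * p <= q.+1]. *)
Lemma inv_cyclo_coef_progression (e : nat) (s : int) :
  (2 * p <= q.+1)%N -> (e <= 1)%N ->
  (forall j, (j <= p - 2)%N -> 'Phi_(p * q)`_(e + j * r) = s) ->
  forall m, (m <= p - 2)%N ->
    inv_cyclo_coef (p * q * r) (e + m * r) = - (s * (m%:Z + 1)) /\
    inv_cyclo_coef (p * q * r) (e + (m + q) * r) = s * (m%:Z + 1).
Proof.
move=> q_ge e_le1 aE m m_le.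
have r_gt1 := prime_gt1 r_pr.
have sumE : s * (m%:Z + 1) = \sum_(i < p) (if (i < m.+1)%N then s else 0).
  have mp : (m.+1 <= p)%N by lia.
  rewrite -big_mkcond -(big_ord_widen p (fun=> s) mp) sumr_const card_ord.
  by rewrite -mulr_natr; congr (_ * _); lia.
(* The cases [d = 0] and [d = q] serve the two blocks. *)
have termE i d : ('Phi_(p * q) * 'X^((i + d) * r))`_(e + (m + d) * r)
               = if (i < m.+1)%N then s else 0.
  rewrite coefMXn ltnS; case: (leqP i m) => im.
    have -> : (e + (m + d) * r < (i + d) * r)%N = false by nia.
    by rewrite -(aE (m - i)%N) ?mulnBl //; [congr (_`_ _); nia | lia].
  by have -> : (e + (m + d) * r < (i + d) * r)%N by nia.
rewrite !inv_cyclo_coef_mul3 // sumE -sumrN.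
split; apply: eq_bigr => i _; have ip := ltn_ord i.
  rewrite coef_CyclotomicMXn_out ?sub0r; last by nia.
  by have := termE i 0%N; rewrite !addn0 => ->.
by rewrite termE (coef_CyclotomicMXn_out i) ?subr0 //; nia.
Qed.

(** Only the shift 0 reaches degree 2, and neither 1 nor 2 lies in the semigroup. *)
Lemma inv_cyclo_coef_2 : (2 < p)%N -> inv_cyclo_coef (p * q * r) 2 = 0.
Proof.
move=> p_gt2; have q_gt2 := ltn_trans p_gt2 lt_pq; have r_gt2 := ltn_trans q_gt2 lt_qr.
rewrite inv_cyclo_coef_mul3 // big1 // => i _; rewrite !coefMXn.
have -> : (2 < (i + q) * r)%N by nia.
case: ltnP => [_|i_small]; first by rewrite subrr.
have -> : i = 0%N :> nat by case: (i : nat) i_small; nia.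
by rewrite mul0n subn0 coef_Cyclotomic_mul2 ?nrep_small ?subrr //; nia.
Qed.

End InverseCyclotomicCoefficients.

(** * The set of coefficient values *)

Lemma inv_cyclo_coef_neq0 (n k : nat) :
  (0 < n)%N -> inv_cyclo_coef n k != 0 -> (k <= n - totient n)%N.
Proof.
move=> n_gt0; apply: contraR; rewrite -ltnNge => lt_k.
rewrite /inv_cyclo_coef nth_default //; apply: leq_trans lt_k.
have Psi_neq0 : inverse_cyclotomic n != 0.
  apply: contra_eq_neq (inverse_cyclotomicK n_gt0) => ->.
  by rewrite mul0r eq_sym monic_neq0 ?monic_Xn_sub_1.
have := congr1 (fun P : {poly int} => size P) (inverse_cyclotomicK n_gt0).
rewrite size_Mmonic ?Cyclotomic_monic // size_XnsubC // size_Cyclotomic addnS /=.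
lia.
Qed.

Lemma inv_cyclo_values_mul3 (p q r e : nat) (s : int) :
  prime p -> prime q -> prime r -> (2 < p)%N -> (p < q)%N -> (q < r)%N ->
  (2 * p <= q.+1)%N -> (e <= 1)%N -> s \in [:: 1; -1] ->
  (forall j, (j <= p - 2)%N -> 'Phi_(p * q)`_(e + j * r) = s) ->
  inv_cyclo_values (p * q * r) =i [pred v : int | - (p%:Z - 1) <= v <= p%:Z - 1].
Proof.
move=> p_pr q_pr r_pr p_gt2 lt_pq lt_qr q_ge e_le1 s_pm aE v; rewrite [RHS]inE -ler_norml.
have n_gt0 : (0 < p * q * r)%N by rewrite !muln_gt0 !prime_gt0.
have prog := inv_cyclo_coef_progression p q r p_pr q_pr r_pr lt_pq lt_qr e s q_ge e_le1 aE.
have s_neq0 : s != 0 by move: s_pm; rewrite !inE => /orP[]/eqP->.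
have mem k : inv_cyclo_coef (p * q * r) k != 0 ->
    inv_cyclo_coef (p * q * r) k \in inv_cyclo_values (p * q * r).
  by move=> /inv_cyclo_coef_neq0 k_le; apply: map_f; rewrite mem_iota add0n ltnS k_le.
apply/mapP/idP => [[k _ ->]|v_le]; first exact: norm_inv_cyclo_coef_mul3.
(* The value 0 occurs at index 2, which is in range because the nonzero coefficient at [e + q * r]
   has a larger index. *)
apply/mapP; have [->|v_neq0] := eqVneq v 0.
  rewrite -(inv_cyclo_coef_2 p q r) //; apply: map_f; rewrite mem_iota add0n ltnS.
  have [_ c_qr] := prog 0%N isT.
  have : inv_cyclo_coef (p * q * r) (e + (0 + q) * r) != 0 by rewrite c_qr mulr1.
  by move=> /(inv_cyclo_coef_neq0 _ _ n_gt0); apply: leq_trans; nia.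
(* A nonzero [v] has absolute value [m + 1]; its sign relative to [s] selects the block. *)
pose m := `|v|.-1%N.
have [c1 c2] := prog m ltac:(lia).
have [->|->] : v = - (s * (m%:Z + 1)) \/ v = s * (m%:Z + 1).
- by move: s_pm; rewrite !inE => /orP[]/eqP->; lia.
- by rewrite -c1 mem // c1; lia.
- by rewrite -c2 mem // c2; lia.
Qed.

(** * Multiples of [r] in the semigroup *)

Section ArithmeticProgression.

Variables p q r : nat.
Hypotheses (p_pr : prime p) (q_pr : prime q) (lt_pq : (p < q)%N) (lt_qr : (q < r)%N).
Hypothesis r_small : ((p - 2) * r < (p - 1) * (q - 1))%N.
Hypothesis dvd_rq : (p %| r - q)%N.

Let pq : p != q. Proof. by rewrite neq_ltn lt_pq. Qed.
Let co_pq : coprime p q. Proof. by rewrite prime_coprime ?dvdn_prime2. Qed.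
Let p_gt1 : (1 < p)%N. Proof. exact: prime_gt1. Qed.

(** Subtracting [(p - 2) * q] from both sides of [r_small] leaves
    [(p - 2) * (r - q) < q - p + 1]. *)
Lemma mul_subn_small (j : nat) : (j <= p - 2)%N -> (j * (r - q) + p <= q)%N.
Proof.
move=> j_le; have := leq_mul j_le (leqnn (r - q)); rewrite mulnBr.
by have := leq_mul (leqnn (p - 2)) (ltnW lt_qr); nia.
Qed.

Lemma mulr_lt_mul (j : nat) : (j <= p - 2)%N -> ((j * r).+1 < p * q)%N.
Proof.
move=> j_le; apply: leq_ltn_trans (_ : (p - 1) * (q - 1) < p * q)%N.
  by apply: leq_ltn_trans r_small; rewrite leq_mul2r j_le orbT.
by rewrite ltn_mul //; lia.
Qed.

Lemma mulr_decomp (j : nat) : (j * r = j * (r - q) + j * q)%N.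
Proof. by rewrite -mulnDr subnK // ltnW. Qed.

(** Write [j * r = j * (r - q) + j * q], where [p] divides [r - q] and [j * (r - q) < q]. *)
Lemma nrep_mulr (j : nat) : (j <= p - 2)%N -> nrep p q (j * r) = 1%N.
Proof.
move=> j_le; have /dvdnP[d rqE] := dvd_rq; have := mul_subn_small j j_le.
have -> : (j * r = j * d * p + j * q)%N by rewrite -mulnA -rqE; nia.
by rewrite rqE => h; apply: nrep_eq1 => //; nia.
Qed.

(** The predecessor of [j * r], if any, is not represented: it falls short of [j.+1 * q] by
    [q.+1 - j * (r - q)], a positive multiple of [p]. *)
Lemma coef_Cyclotomic_mulr (j : nat) :
  (p %| q.+1)%N -> (j <= p - 2)%N -> 'Phi_(p * q)`_(j * r) = 1.
Proof.
move=> dvd_q j_le; have jr_lt := mulr_lt_mul j j_le; have small := mul_subn_small j j_le.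
have jrE := mulr_decomp j.
rewrite coef_Cyclotomic_mul2 ?nrep_mulr ?(ltnW jr_lt) //.
case ejr: (j * r)%N => [|k]; rewrite ?subr0 // (nrep_eq0 p q j.+1) ?subr0 ?mulSn //; try lia.
have -> : (q + j * q - k = q.+1 - j * (r - q))%N by lia.
by rewrite dvdn_sub ?dvdn_mull.
Qed.

(** Here the successor of [j * r] falls short of [j.+1 * q] by [q - 1 - j * (r - q)], again a
    positive multiple of [p]. *)
Lemma coef_Cyclotomic_add1_mulr (j : nat) :
  (p %| q - 1)%N -> (j <= p - 2)%N -> 'Phi_(p * q)`_(1 + j * r) = -1.
Proof.
move=> dvd_q j_le; have jr_lt := mulr_lt_mul j j_le; have small := mul_subn_small j j_le.
have jrE := mulr_decomp j.
rewrite coef_Cyclotomic_mul2 // add1n nrep_mulr // (nrep_eq0 p q j.+1) ?mulSn //; try lia.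
have -> : (q + j * q - (j * r).+1 = (q - 1) - j * (r - q))%N by lia.
by rewrite dvdn_sub ?dvdn_mull.
Qed.

End ArithmeticProgression.

(** * From the congruences to the two cases of the theorem *)

Lemma dvdn_of_eqz_modN1 (p n : nat) : (n%:Z = -1 %[mod p%:Z])%Z -> (p %| n.+1)%N.
Proof. by move/eqP; rewrite eqz_mod_dvd opprK -PoszD dvdzE addn1. Qed.

Lemma dvdn_of_eqz_mod1 (p n : nat) :
  (0 < n)%N -> (n%:Z = 1 %[mod p%:Z])%Z -> (p %| n - 1)%N.
Proof. by move=> n_gt0 /eqP; rewrite eqz_mod_dvd subzn // dvdzE. Qed.

Theorem theorem4 (p q r : nat)
    (p_prime : prime p) (q_prime : prime q) (r_prime : prime r)
    (p_odd : odd p) (q_odd : odd q) (r_odd : odd r)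
    (lt_pq : (p < q)%N) (lt_qr : (q < r)%N)
    (r_lt : r%:R < (p%:R - 1) * (q%:R - 1) / (p%:R - 2) :> rat) :
  ((q%:Z = -1 %[mod p%:Z])%Z -> (r%:Z = -1 %[mod p%:Z])%Z ->
     [/\ forall m : nat, (m <= p - 2)%N ->
           inv_cyclo_coef (p * q * r) (m * r) = - 1 - m%:Z /\
           inv_cyclo_coef (p * q * r) ((m + q) * r) = m%:Z + 1,
         inv_cyclo_coef (p * q * r) 2 = 0
       & inv_cyclo_values (p * q * r)
           =i [pred v : int | - (p%:Z - 1) <= v <= p%:Z - 1]])
  /\
  ((q%:Z = 1 %[mod p%:Z])%Z -> (r%:Z = 1 %[mod p%:Z])%Z ->
     [/\ forall m : nat, (m <= p - 2)%N ->
           inv_cyclo_coef (p * q * r) (1 + m * r) = 1 + m%:Z /\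
           inv_cyclo_coef (p * q * r) (1 + (m + q) * r) = - 1 - m%:Z,
         inv_cyclo_coef (p * q * r) 2 = 0
       & inv_cyclo_values (p * q * r)
           =i [pred v : int | - (p%:Z - 1) <= v <= p%:Z - 1]]).
Proof.
have odd_gt2 n : prime n -> odd n -> (2 < n)%N.
  by move=> n_pr; apply: contraTT; have := prime_gt1 n_pr; case: n {n_pr} => [|[|[|]]].
have p_gt2 := odd_gt2 p p_prime p_odd.
have r_small : ((p - 2) * r < (p - 1) * (q - 1))%N.
  have p2E : p%:R - 2 = (p - 2)%N%:R :> rat by rewrite natrB // ltnW.
  move: r_lt; rewrite ltr_pdivlMr p2E ?ltr0n ?subn_gt0 //.
  rewrite -(natrB _ (prime_gt0 p_prime)) -(natrB _ (prime_gt0 q_prime)).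
  by rewrite -!natrM ltr_nat mulnC.
split=> [/dvdn_of_eqz_modN1 dvd_q /dvdn_of_eqz_modN1 dvd_r |
         /(dvdn_of_eqz_mod1 _ _ (prime_gt0 q_prime)) dvd_q
         /(dvdn_of_eqz_mod1 _ _ (prime_gt0 r_prime)) dvd_r].
- have dvd_rq : (p %| r - q)%N by rewrite -subSS dvdn_sub.
  have q_ge : (2 * p <= q.+1)%N.
    by case/dvdnP: dvd_q => -[|[|d]] e; [lia | lia | rewrite e leq_mul2r orbT].
  have aE j : (j <= p - 2)%N -> 'Phi_(p * q)`_(0 + j * r) = 1.
    by move=> j_le; rewrite add0n coef_Cyclotomic_mulr.
  split; last 1 first.
  + by apply: (inv_cyclo_values_mul3 p q r 0 1).
  + move=> m m_le; have := inv_cyclo_coef_progression p q r _ _ _ _ _ 0 1 _ _ aE m m_le.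
    by rewrite !add0n mul1r opprD addrC; apply.
  + exact: inv_cyclo_coef_2.
- have dvd_rq : (p %| r - q)%N.
    by rewrite -(subnKC (prime_gt0 q_prime)) subnDA dvdn_sub.
  have q_ge : (2 * p <= q.+1)%N.
    case/dvdnP: dvd_q => -[|[|d]] e; [lia | | ].
      (* Quotient 1 would give [q = p + 1], which is even. *)
      by move: q_odd; rewrite (_ : q = p.+1) /= ?p_odd //; lia.
    by have := leq_mul (isT : 2 <= d.+2)%N (leqnn p); lia.
  have aE j : (j <= p - 2)%N -> 'Phi_(p * q)`_(1 + j * r) = -1.
    by move=> j_le; rewrite coef_Cyclotomic_add1_mulr.
  split; last 1 first.
  + by apply: (inv_cyclo_values_mul3 p q r 1 (-1)).
  + move=> m m_le; have := inv_cyclo_coef_progression p q r _ _ _ _ _ 1 (-1) _ _ aE m m_le.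
    by rewrite mulN1r opprK opprD [- _ - 1]addrC [_ + 1]addrC; apply.
  + exact: inv_cyclo_coef_2.
Qed.
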